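(* Let $(\mathfrak g,[\cdot,\cdot],\alpha)$ be a multiplicative Hom-Lie superalgebra over $\mathbb K$, let $n\ge 2$ and $k\ge 0$ be integers, and let $\mathfrak D=\mathfrak D^{(0)},\mathfrak D'=\mathfrak D^{(1)},\dots,\mathfrak D^{(n-1)}$ be homogeneous endomorphisms of $\mathfrak g$ such that, for each $0\le i\le n-2$, $\mathfrak D^{(i)}$ is an $\alpha^k$-quasiderivation of $\mathfrak g$ with associated endomorphism $\mathfrak D^{(i+1)}$. Then the $(n+1)$-tuple $(\mathfrak D,\mathfrak D,\mathfrak D',\mathfrak D'',\dots,\mathfrak D^{(n-1)})$ is an $(n+1)$-ary $\alpha^k$-derivation of $\mathfrak g_n=(\mathfrak g,[\cdot,\dots,\cdot]_n,\alpha^{n-1})$; that is, for all homogeneous $x_1,\dots,x_n\in\mathfrak g$, $$\mathfrak D^{(n-1)}([x_1,\dots,x_n]_n)=[\mathfrak D(x_1),\alpha^k(x_2),\dots,\alpha^k(x_n)]_n+\sum_{i=2}^n(-1)^{|\mathfrak D^{(i-2)}||X|^{i-1}}[\alpha^k(x_1),\dots,\alpha^k(x_{i-1}),\mathfrak D^{(i-2)}(x_i),\alpha^k(x_{i+1}),\dots,\alpha^k(x_n)]_n,$$ where $|X|^{i-1}=\sum_{l=1}^{i-1}|x_l|$.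
   Context: $\mathbb K$ is an algebraically closed field of characteristic zero. $|v|\in\mathbb Z_2$ denotes the degree of a homogeneous element (or endomorphism) $v$; a map is even if it preserves total degree. $\alpha^k$ is the $k$-fold composition of $\alpha$, $\alpha^0=\mathrm{Id}$. A Hom-Lie superalgebra $(\mathfrak g,[\cdot,\cdot],\alpha)$ is a $\mathbb Z_2$-graded linear space with an even bilinear map $[\cdot,\cdot]$ and an even linear map $\alpha:\mathfrak g\to\mathfrak g$ such that for homogeneous $x,y,z$: $[x,y]=-(-1)^{|x||y|}[y,x]$ and $(-1)^{|x||z|}[\alpha(x),[y,z]]+(-1)^{|y||x|}[\alpha(y),[z,x]]+(-1)^{|z||y|}[\alpha(z),[x,y]]=0$. It is multiplicative if $\alpha([x,y])=[\alpha(x),\alpha(y)]$. The $n$-ary bracket is defined by $[x_1,x_2]_2=[x_1,x_2]$ and $[x_1,\dots,x_m]_m=\big[[x_1,\dots,x_{m-1}]_{m-1},\alpha^{m-2}(x_m)\big]$ for $m\ge 3$. An endomorphism $\mathfrak D$ of $\mathfrak g$ is an $\alpha^k$-quasiderivation with associated endomorphism $\mathfrak D'$ if $[\mathfrak D(x),\alpha^k(y)]+(-1)^{|\mathfrak D||x|}[\alpha^k(x),\mathfrak D(y)]=\mathfrak D'([x,y])$ for all homogeneous $x,y\in\mathfrak g$. In general, an $(n+1)$-tuple $(E_0,E_1,\dots,E_n)$ of endomorphisms of a space with $n$-ary bracket is called an $(n+1)$-ary $\alpha^k$-derivation if $E_n([x_1,\dots,x_n])=\sum_{i=1}^n(-1)^{|E_{i-1}||X|^{i-1}}[\alpha^k(x_1),\dots,E_{i-1}(x_i),\dots,\alpha^k(x_n)]$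 for all homogeneous $x_1,\dots,x_n$.
   Formalization: The formal theorem additionally assumes that D^(i) commutes with α for 1 ≤ i ≤ n−2 (no condition when n = 2); without this the claim is false, e.g. for n = 3, k = 0 on 2×2 matrices with the commutator twisted by a conjugation. *)

(* Defs.v *)
From mathcomp Require Import all_boot all_order all_algebra.

Set Implicit Arguments.
Unset Strict Implicit.
Unset Printing Implicit Defensive.

Import GRing.Theory.
Local Open Scope ring_scope.

Definition zsign (K : nzRingType) (a : 'Z_2) : K := (-1) ^+ a.
Arguments zsign {K} a.

(* [G i] is the component of degree [i].  Components are [Prop]-valued so that
   the space may have any dimension and need no decidable membership.  The zero
   vector is homogeneous of both degrees, so "homogeneous of degree i" is always
   expressed by [G i v] rather than by a degree function. *)
Record is_supergrading (K : fieldType) (V : lmodType K)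
    (G : 'Z_2 -> V -> Prop) : Prop := IsSupergrading {
  supergrading0 : forall i, G i 0;
  supergradingP : forall i (a : K) u v, G i u -> G i v -> G i (a *: u + v);
  supergrading_sum :
    forall v, exists u0 u1, [/\ G 0 u0, G 1 u1 & v = u0 + u1];
  supergrading_direct : forall v, G 0 v -> G 1 v -> v = 0
}.

Record homLieSuperalgebra (K : fieldType) := HomLieSuperalgebra {
  hls_sort :> lmodType K;
  hls_comp : 'Z_2 -> hls_sort -> Prop;
  hls_br : {bilinear hls_sort -> hls_sort -> hls_sort};
  hls_twist : {linear hls_sort -> hls_sort};
  hls_grading : is_supergrading hls_comp;
  hls_br_even : forall i j x y, hls_comp i x -> hls_comp j y -> hls_comp (i + j) (hls_br x y);
  hls_twist_even : forall i x, hls_comp i x -> hls_comp i (hls_twist x);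
  hls_br_skew : forall i j x y, hls_comp i x -> hls_comp j y ->
    hls_br x y = - (zsign (i * j) *: hls_br y x);
  hls_br_jacobi : forall i j l x y z, hls_comp i x -> hls_comp j y -> hls_comp l z ->
    zsign (i * l) *: hls_br (hls_twist x) (hls_br y z)
    + zsign (j * i) *: hls_br (hls_twist y) (hls_br z x)
    + zsign (l * j) *: hls_br (hls_twist z) (hls_br x y) = 0
}.

Arguments hls_comp {K} g _ _ : rename.
Arguments hls_br {K} g : rename.
Arguments hls_twist {K} g : rename.

Section HomLieSuperalgebra.
Variables (K : fieldType) (g : homLieSuperalgebra K).

Definition hls_multiplicative : Prop :=
  forall x y : g, hls_twist g (hls_br g x y) = hls_br g (hls_twist g x) (hls_twist g y).

Definition homogeneous_endo (d : 'Z_2) (D : {linear g -> g}) : Prop :=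
  forall i x, hls_comp g i x -> hls_comp g (d + i) (D x).

(* [d] is the degree of [D].  Commutation of [D] with the twist is not part of this
   notion; without it, n-ary brackets for n >= 3 need not be compatible with chains of
   quasiderivations, because the last argument of [nbracket] is twisted. *)
Definition quasiderivation (k : nat) (d : 'Z_2) (D D' : {linear g -> g}) : Prop :=
  forall i j x y, hls_comp g i x -> hls_comp g j y ->
    hls_br g (D x) (iter k (hls_twist g) y)
    + zsign (d * i) *: hls_br g (iter k (hls_twist g) x) (D y) = D' (hls_br g x y).

(* The bracket [x_1, ..., x_n]_n, with x_1, ..., x_n indexed by 0, ..., n-1.
   The recursion starts from [x_1]_1 = x_1, which gives [x_1, x_2]_2 = [x_1, x_2];
   the value for n = 0 is a dummy. *)
Fixpoint nbracket (n : nat) : ('I_n -> g) -> g :=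
  match n with
  | 0 => fun _ => 0
  | m.+1 => fun x =>
      if m is p.+1 then
        hls_br g (nbracket (fun i : 'I_m => x (widen_ord (leqnSn m) i)))
             (iter p (hls_twist g) (x ord_max))
      else x ord_max
  end.

(* (n+1)-ary alpha^k-derivations for an n-ary bracket [B] on g, where alpha is
   [hls_twist g].  [e i] is the degree of [E i] for i < n; since arguments are indexed
   from 0, |X|^{i-1} is the sum of the degrees of the arguments before the one to
   which the endomorphism is applied. *)
Definition nary_derivation (n k : nat) (B : ('I_n -> g) -> g)
    (e : 'I_n.+1 -> 'Z_2) (E : 'I_n.+1 -> {linear g -> g}) : Prop :=
  forall (a : 'I_n -> 'Z_2) (x : 'I_n -> g), (forall i, hls_comp g (a i) (x i)) ->
    E ord_max (B x) =
    \sum_(i < n)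
      zsign (e (widen_ord (leqnSn n) i) * \sum_(l < n | (l < i)%N) a l) *:
      B (fun j => if j == i then E (widen_ord (leqnSn n) i) (x j)
                  else iter k (hls_twist g) (x j)).

End HomLieSuperalgebra.

Arguments hls_multiplicative {K} g.

(* Main.v *)
Require Import Defs.
From mathcomp Require Import all_boot all_order all_algebra.
Local Open Scope ring_scope.

(** Write [B_m] for the [m]-ary bracket.  As it is left-nested,
      B_(n+1)(x_1, ..., x_(n+1)) = br (B_n(x_1, ..., x_n)) (alpha^(n-1) x_(n+1)),
    the result follows by induction on the arity.  Put [b := B_n(x_1, ..., x_n)]
    and [y := alpha^(n-1) x_(n+1)].  As [D (n-1)] is a quasiderivation with
    associated endomorphism [D n],
      D n (br b y) = br (D (n-1) b) (alpha^k y)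
                     + (-1)^(d (n-1) * |b|) br (alpha^k b) (D (n-1) y).
    The induction hypothesis expands [D (n-1) b], so that the first term yields the
    summands in which one of the first [n] arguments is hit.  The second term is
    the summand in which the last argument is hit: [alpha^k] enters [b] by
    multiplicativity ([iter_twist_nbracket]), [D (n-1)] moves past [alpha^(n-1)]
    because it commutes with [alpha] if [n > 1] and because the power is trivial if
    [n = 1], and the sign is the expected one because [b] has degree
    [|x_1| + ... + |x_n|] ([nbracket_homogeneous]).  The degrees of the different
    [D i] never interact: each summand carries only the sign that comes from the
    one endomorphism in it.

    The induction starts at arity 1, where the bracket is the identity and the claim
    reads [D 0 x = D 0 x]; arity 2 is then an instance of the induction step. *)

Section NaryBracket.
Set Implicit Arguments.
Unset Strict Implicit.
Unset Printing Implicit Defensive.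
Import GRing.Theory.
Variables (K : fieldType) (g : homLieSuperalgebra K).
Implicit Types (n k : nat).
Arguments nbracket : simpl never.

Local Notation alpha := (hls_twist g).
Local Notation br := (hls_br g).

Lemma nbracketSS n (x : 'I_n.+2 -> g) :
  nbracket x = br (nbracket (fun i : 'I_n.+1 => x (widen_ord (leqnSn n.+1) i)))
                  (iter n alpha (x ord_max)).
Proof. by []. Qed.

Lemma eq_nbracket n (x y : 'I_n -> g) : x =1 y -> nbracket x = nbracket y.
Proof.
case: n x y => [|n] //; elim: n => [|n IHn] x y eq_xy; first exact: eq_xy.
by rewrite !nbracketSS eq_xy; congr (br _ _); apply: IHn => i; apply: eq_xy.
Qed.

Lemma iter_twist_homogeneous k i (x : g) :
  hls_comp g i x -> hls_comp g i (iter k alpha x).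
Proof. by move=> xi; elim: k => [|k IHk] //=; apply: hls_twist_even. Qed.

Lemma nbracket_homogeneous n (a : 'I_n -> 'Z_2) (x : 'I_n -> g) :
  (forall i, hls_comp g (a i) (x i)) -> hls_comp g (\sum_i a i) (nbracket x).
Proof.
case: n a x => [|n] a x xa.
  by rewrite big_ord0; apply: (supergrading0 (hls_grading g)).
elim: n a x xa => [|n IHn] a x xa.
  by rewrite big_ord_recr big_ord0 /= add0r; apply: xa.
rewrite nbracketSS big_ord_recr /=; apply: hls_br_even.
  exact: (IHn _ _ (fun i => xa (widen_ord (leqnSn n.+1) i))).
exact: iter_twist_homogeneous.
Qed.

Lemma iter_twist_br (g_mult : hls_multiplicative g) k (x y : g) :
  iter k alpha (br x y) = br (iter k alpha x) (iter k alpha y).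
Proof. by elim: k => //= k ->; apply: g_mult. Qed.

Lemma iter_twist_nbracket (g_mult : hls_multiplicative g) k n (x : 'I_n.+1 -> g) :
  iter k alpha (nbracket x) = nbracket (fun i => iter k alpha (x i)).
Proof.
elim: n x => [|n IHn] x //.
by rewrite !nbracketSS iter_twist_br // IHn -!iterD addnC.
Qed.

Lemma sum_prefix_widen (V : nmodType) n m (a : 'I_n.+1 -> V) : (m <= n)%N ->
  \sum_(l < n.+1 | (l < m)%N) a l
    = \sum_(l < n | (l < m)%N) a (widen_ord (leqnSn n) l).
Proof.
by move=> le_mn; rewrite big_mkcond big_ord_recr /= ltnNge le_mn addr0 -big_mkcond.
Qed.

(** The statement is indexed by [n.+1] to include arity
    1, from which the induction starts. *)
Lemma quasiderivation_chain_nary_derivation (g_mult : hls_multiplicative g) k n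
    (d : nat -> 'Z_2) (D : nat -> {linear g -> g}) :
    (forall i, (i < n)%N -> quasiderivation k (d i) (D i) (D i.+1)) ->
    (forall i, (0 < i < n)%N -> forall x : g, D i (alpha x) = alpha (D i x)) ->
  nary_derivation k (@nbracket K g n.+1)
    (fun i : 'I_n.+2 => d i.-1) (fun i : 'I_n.+2 => D i.-1).
Proof.
elim: n => [|n IHn] Dq Dt a x xa.
  by rewrite big_ord1 big1 ?mulr0 ?scale1r //= ?eqxx // => l; rewrite ltn0.
set a' := fun i : 'I_n.+1 => a (widen_ord (leqnSn n.+1) i).
set x' := fun i : 'I_n.+1 => x (widen_ord (leqnSn n.+1) i).
have x'a' i : hls_comp g (a' i) (x' i) by apply: xa.
have Dq' i : (i < n)%N -> quasiderivation k (d i) (D i) (D i.+1).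
  by move=> lt_in; apply/Dq/ltnW.
have Dt' i : (0 < i < n)%N -> forall y : g, D i (alpha y) = alpha (D i y).
  by case/andP=> i_gt0 lt_in; apply: Dt; rewrite i_gt0 ltnW.
have /= IH := IHn Dq' Dt' a' x' x'a'.
have Dn_twist y : D n (iter n alpha y) = iter n alpha (D n y).
  have [n0|n_gt0] := posnP n; first by rewrite n0.
  have Dn_alpha := Dt n; rewrite n_gt0 ltnSn in Dn_alpha.
  by elim: {2 3}n => //= m <-; apply: Dn_alpha.
rewrite nbracketSS -(Dq _ (ltnSn n) _ _ _ _ (nbracket_homogeneous x'a')
  (iter_twist_homogeneous n (xa ord_max))).
rewrite -/x' IH linear_sumlz [RHS]big_ord_recr; congr (_ + _).
- apply: eq_bigr => i _; rewrite linearZl_LR /= nbracketSS.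
  rewrite (sum_prefix_widen _ (ltnW (ltn_ord i))).
  congr (_ *: br _ _).
  have /negPf -> : ord_max != widen_ord (leqnSn n.+1) i :> 'I_n.+2.
    by rewrite -val_eqE /= neq_ltn ltn_ord orbT.
  by rewrite -!iterD addnC.
- rewrite sum_prefix_widen //.
  under [in RHS]eq_bigl => l do rewrite ltn_ord.
  rewrite nbracketSS eqxx Dn_twist // iter_twist_nbracket //=.
  congr (_ *: br _ _); apply: eq_nbracket => i.
  have /negPf -> // : widen_ord (leqnSn n.+1) i != ord_max.
  by rewrite -val_eqE /= neq_ltn ltn_ord.
Qed.

End NaryBracket.

Theorem proposition3p6 (K : closedFieldType) (K_char0 : [pchar K] =i pred0)
    (g : homLieSuperalgebra K) (g_mult : hls_multiplicative g)
    (n k : nat) (n_ge2 : (2 <= n)%N)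
    (d : nat -> 'Z_2) (D : nat -> {linear g -> g})
    (D_homog : forall i, (i < n)%N -> homogeneous_endo (d i) (D i))
    (D_quasi : forall i, (i.+1 < n)%N -> quasiderivation k (d i) (D i) (D i.+1))
    (D_twist : forall i, (0 < i)%N -> (i.+1 < n)%N ->
       forall x : g, D i (hls_twist g x) = hls_twist g (D i x)) :
  nary_derivation k (@nbracket K g n)
    (fun i : 'I_n.+1 => d i.-1) (fun i : 'I_n.+1 => D i.-1).
Proof.
case: n n_ge2 D_homog D_quasi D_twist => // n _ _ Dq Dt.
apply: quasiderivation_chain_nary_derivation => // i /andP[i_gt0 lt_in].
exact: Dt.
Qed.
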